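(* If $\Pi\subseteq\mathfrak S_n$ forms an allowable graph of permutations, then $\mathcal T_\Pi=\{X^\sigma:\sigma\in\Pi\}$ is the set of topes of a sweep acycloid. Conversely, if $\mathcal T$ is the set of topes of a sweep acycloid whose support is all of $\binom{[n]}{2}$, then $\Pi_{\mathcal T}=\{I_X: X\in\mathcal T\}$ (a set of permutations) forms an allowable graph of permutations.
   Context: Permutations $\sigma\in\mathfrak S_n$ are words $[\sigma(1),\dots,\sigma(n)]$; a substring is a contiguous subword. A move is a set of one or more pairwise disjoint substrings (length $\ge2$), applied to $\sigma$ by reversing each of them. Its inversion set $\mathrm{Inv}_m$ is the set of pairs $(i,j)$, $i<j$, of letters in a common substring of $m$. An allowable sequence in $\Pi$ from $\sigma$ to $\sigma'$ is a sequence $\sigma=\sigma_0,\dots,\sigma_l=\sigma'$ in $\Pi$, each obtained from the previous by a move $m_k$, with the $\mathrm{Inv}_{m_k}$ pairwise disjoint. $\bar\sigma(t)=\sigma(n-t+1)$. $\Pi\subseteq\mathfrak S_n$ forms an allowable graph of permutations if there is a set $\mathcal M$ of moves with (P1) $\Pi$ closed under $\sigma\mapsto\bar\sigma$; (P2) any two elements of $\Pi$ are joined by an allowable sequence in $\Pi$ with moves in $\mathcal M$; (P3) for $m,s\in\mathcal M$, $\mathrm{Inv}_m=\mathrm{Inv}_s$ or $\mathrm{Inv}_m\cap\mathrm{Inv}_s=\emptyset$. $\binom{[n]}{2}$ is the set of pairs $(i,j)$, $i<j$. For an ordered partition $I$ of $[n]$ with block-index map $p_I$, $X^I_{(i,j)}=+,-,0$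 according as $p_I(i)<,>,=p_I(j)$; conversely $I_X$ denotes the ordered partition with $X^{I_X}=X$ (when it exists); for a permutation, $X^\sigma$ is $X^I$ for the partition into singletons $(\{\sigma(1)\},\dots,\{\sigma(n)\})$. Acycloid: a set $\mathcal T\subseteq\{+,-,0\}^E$ with (T1) common support; (T2) closed under negation; (T3) for $X\ne Y$ in $\mathcal T$ there is $f\in S(X,Y)=\{e:\{X_e,Y_e\}=\{+,-\}\}$ with ${}_{-[f]}X\in\mathcal T$, where $[f]$ is the parallelism class of $f$ (elements $g$ with $X_g=X_f$ for all $X\in\mathcal T$ or $X_g=-X_f$ for all $X\in\mathcal T$) and ${}_{-F}X$ negates entries in $F$. A sweep acycloid is an acycloid on $\binom{[n]}{2}$ such that (i) for every tope $X$ and $1\le i<j<k\le n$ the triple $(X_{(i,j)},X_{(j,k)},X_{(i,k)})$ is orthogonal to $(+,+,-)$, and (ii) for any three distinct $a,b,c\in[n]$, if the parallelism class containing the pair $\{a,b\}$ contains $\{b,c\}$, then it also contains $\{a,c\}$ (where $\{x,y\}$ denotes $(\min,\max)$). Two sign vectors are orthogonal if their supports are disjoint or their restrictions to the common support are neither equal nor opposite. *)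

(* Defs.v *)
From HB Require Import structures.
From mathcomp Require Import all_boot all_fingroup.

Set Implicit Arguments.
Unset Strict Implicit.
Unset Printing Implicit Defensive.

Inductive sign : Set := Pos | Neg | Zero.

Definition sign_code (s : sign) : option bool :=
  match s with Pos => Some true | Neg => Some false | Zero => None end.

Definition sign_decode (o : option bool) : sign :=
  match o with Some true => Pos | Some false => Neg | None => Zero end.

Lemma sign_codeK : cancel sign_code sign_decode.
Proof. by case. Qed.

HB.instance Definition _ := Finite.copy sign (can_type sign_codeK).

Definition neg (s : sign) : sign :=
  match s with Pos => Neg | Neg => Pos | Zero => Zero end.

Section SignVectors.

Variable E : finType.

Definition signvec : finType := {ffun E -> sign}.

Implicit Types (X Y : signvec) (T : {set signvec}) (F : {set E}).

Definition supp X : {set E} := [set e | X e != Zero].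

Definition oppv X : signvec := [ffun e => neg (X e)].

Definition separation X Y : {set E} :=
  [set e | [set X e; Y e] == [set Pos; Neg]].

Definition negate_on F X : signvec :=
  [ffun e => if e \in F then neg (X e) else X e].

Definition orthogonal X Y : bool :=
  [disjoint supp X & supp Y] ||
  (~~ [forall e in supp X :&: supp Y, X e == Y e] &&
   ~~ [forall e in supp X :&: supp Y, X e == neg (Y e)]).

Definition parclass T (f : E) : {set E} :=
  [set g | [forall X in T, X g == X f] || [forall X in T, X g == neg (X f)]].

(* An acycloid is identified with its set of topes.  The empty set of topes is
   not excluded, just as the empty set of permutations is an allowable graph. *)
Definition acycloid T : Prop :=
  [/\ forall X Y, X \in T -> Y \in T -> supp X = supp Y,
      forall X, X \in T -> oppv X \in T
    & forall X Y, X \in T -> Y \in T -> X <> Y ->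
        exists2 f, f \in separation X Y & negate_on (parclass T f) X \in T].

End SignVectors.

(* Letters and positions are numbered from 0: the set [n] is 'I_n. *)

Definition pairs (n : nat) : finType := {p : 'I_n * 'I_n | p.1 < p.2}.

Definition mkpair n (i j : 'I_n) (ij : i < j) : pairs n :=
  exist (fun p : 'I_n * 'I_n => is_true (p.1 < p.2)) (i, j) ij.

Lemma minmax_subproof n (a b : 'I_n) (ab : a != b) :
  let p := if a < b then (a, b) else (b, a) in p.1 < p.2.
Proof. by case: ltngtP ab => //= /val_inj ->; rewrite eqxx. Qed.

(* The pair (min a b, max a b). *)
Definition upair n (a b : 'I_n) (ab : a != b) : pairs n :=
  exist (fun p : 'I_n * 'I_n => is_true (p.1 < p.2)) _ (minmax_subproof ab).

Definition triple (x y z : sign) : signvec 'I_3 :=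
  [ffun k : 'I_3 => nth Zero [:: x; y; z] k].

Definition sweep_acycloid n (T : {set signvec (pairs n)}) : Prop :=
  [/\ acycloid T,
      forall (X : signvec (pairs n)) (i j k : 'I_n)
          (ij : i < j) (jk : j < k) (ik : i < k),
        X \in T ->
        orthogonal (triple (X (mkpair ij)) (X (mkpair jk)) (X (mkpair ik)))
                   (triple Pos Pos Neg)
    & forall (a b c : 'I_n) (ab : a != b) (bc : b != c) (ac : a != c),
        upair bc \in parclass T (upair ab) ->
        upair ac \in parclass T (upair ab)].

Section Partitions.

Variable n : nat.

Implicit Types (I : seq {set 'I_n}) (X : signvec (pairs n)) (sigma : 'S_n).

Definition ordered_partition I : bool :=
  uniq I && partition [set B in I] [set: 'I_n].

Definition block_index I (i : 'I_n) : nat :=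
  find (fun B : {set 'I_n} => i \in B) I.

Definition sv_of_partition I : signvec (pairs n) :=
  [ffun e : pairs n =>
     let p := block_index I (val e).1 in
     let q := block_index I (val e).2 in
     if p < q then Pos else if q < p then Neg else Zero].

Definition singletons sigma : seq {set 'I_n} :=
  [seq [set sigma t] | t <- enum 'I_n].

Definition sv_of_perm sigma : signvec (pairs n) :=
  sv_of_partition (singletons sigma).

(* I is the ordered partition I_X. *)
Definition partition_of X I : bool :=
  ordered_partition I && (sv_of_partition I == X).

Definition topes_of_perms (Pi : {set 'S_n}) : {set signvec (pairs n)} :=
  [set sv_of_perm sigma | sigma in Pi].

(* The permutations of the form I_X, X in T, a permutation being identified
   with its ordered partition into singletons. *)
Definition perms_of_topes (T : {set signvec (pairs n)}) : {set 'S_n} :=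
  [set sigma | [exists X in T, partition_of X (singletons sigma)]].

End Partitions.

Section AllowableGraphs.

Variable n : nat.

Implicit Types (sigma tau : 'S_n) (Pi : {set 'S_n}).

Definition word sigma : seq 'I_n := [seq sigma t | t <- enum 'I_n].

(* A collection of substrings, each recorded as a word of length at most n. *)
Definition substrings : finType := {set n.-bseq 'I_n}.

Implicit Types (m : substrings) (M : {set substrings}).

(* A substring of a permutation has no repeated letter, and two substrings of
   a permutation are disjoint exactly when they share no letter. *)
Definition is_move m : Prop :=
  [/\ m != set0,
      forall w, w \in m -> (2 <= size w) && uniq w
    & forall v w, v \in m -> w \in m -> v <> w -> ~~ has [in v] w].

(* tau is obtained from sigma by reversing in place the substrings in m. *)
Definition move_step m sigma tau : Prop :=
  [/\ is_move m,
      forall w, w \in m -> exists u v u' v' : seq 'I_n,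
        [/\ word sigma = u ++ w ++ v, word tau = u' ++ rev w ++ v'
          & size u = size u']
    & forall t : 'I_n, (forall w, w \in m -> sigma t \notin w) ->
        tau t = sigma t].

Definition Inv m : {set pairs n} :=
  [set e : pairs n | [exists w in m, ((val e).1 \in w) && ((val e).2 \in w)]].

(* sg 0, ..., sg l are the permutations, and mv k is the move from sg k to
   sg k.+1; values beyond these ranges are irrelevant. *)
Definition allowable_sequence Pi sigma tau
    (l : nat) (sg : nat -> 'S_n) (mv : nat -> substrings) : Prop :=
  [/\ sg 0 = sigma, sg l = tau,
      forall k, k <= l -> sg k \in Pi,
      forall k, k < l -> move_step (mv k) (sg k) (sg k.+1)
    & forall j k, j < k < l -> [disjoint Inv (mv j) & Inv (mv k)]].

(* t |-> sigma (rev_ord t): products of permutations apply left factor first. *)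
Definition revperm sigma : 'S_n := (perm (@rev_ord_inj n) * sigma)%g.

Definition allowable_graph Pi : Prop :=
  exists M : {set substrings},
  [/\ forall m, m \in M -> is_move m,
      forall sigma, sigma \in Pi -> revperm sigma \in Pi,
      forall sigma tau, sigma \in Pi -> tau \in Pi ->
        exists l sg mv, allowable_sequence Pi sigma tau l sg mv /\
                        forall k, k < l -> mv k \in M
    & forall m s, m \in M -> s \in M ->
        Inv m = Inv s \/ [disjoint Inv m & Inv s]].

End AllowableGraphs.

(* Main.v *)
Require Import Defs.
From mathcomp Require Import all_boot all_fingroup.
From mathcomp Require Import zify.

(* A move m from sigma to tau negates X^sigma exactly on Inv m.  Hence, in an
   allowable graph, (P3) makes the signs of X on Inv m vary together along any
   allowable sequence, so Inv m is a parallelism class, and the first move of an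
   allowable sequence from sigma to tau witnesses (T3); (ii) holds because a
   class is a union of complete graphs on disjoint substrings.

   Conversely, each tope of full support is a transitive tournament, that is, a
   permutation.  By (ii) a parallelism class F defines an equivalence relation on
   the letters.  If X^sigma and its negation on F both come from permutations,
   the equivalence classes occupy intervals of positions of sigma, and the second
   permutation is obtained by reversing these intervals: a move with inversion
   set F.  Iterating (T3) removes one parallelism class at a time from the
   separation set of two topes, which gives the allowable sequence. *)

Set Implicit Arguments.
Unset Strict Implicit.
Unset Printing Implicit Defensive.

(** * Moves and positions *)

Lemma negK : involutive neg.
Proof. by case. Qed.

Lemma in_negate_on (E : finType) (F : {set E}) (X : signvec E) e :
  negate_on F X e = if e \in F then neg (X e) else X e.
Proof. by rewrite ffunE. Qed.

Lemma in_separation (E : finType) (X Y : signvec E) e :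
  (e \in separation X Y) = (X e != Zero) && (Y e == neg (X e)).
Proof.
rewrite inE; apply/eqP/andP => [/setP H|[]].
  by move: (H Pos) (H Neg) (H Zero); rewrite !inE; case: (X e); case: (Y e).
move=> X0 /eqP ->; apply/setP => s.
by rewrite !inE; case: (X e) X0; case: s.
Qed.

Lemma parclassP (E : finType) (T : {set signvec E}) (f g : E) :
  reflect ((forall X, X \in T -> X g = X f) \/
           (forall X, X \in T -> X g = neg (X f)))
          (g \in parclass T f).
Proof.
rewrite inE; apply: (iffP orP) => -[] H; [left|right|left|right].
- by move=> X XT; apply/eqP; move/forall_inP: H; apply.
- by move=> X XT; apply/eqP; move/forall_inP: H; apply.
- by apply/forall_inP => X XT; rewrite H.
- by apply/forall_inP => X XT; rewrite H.
Qed.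

Lemma parclass_refl (E : finType) (T : {set signvec E}) f : f \in parclass T f.
Proof. by apply/parclassP; left. Qed.

Lemma parclass_eq (E : finType) (T : {set signvec E}) f g :
  g \in parclass T f -> parclass T g = parclass T f.
Proof.
move/parclassP => gf; apply/setP => h.
apply/parclassP/parclassP => -[] H; case: gf => gf;
  solve [ left => X XT; rewrite H ?gf ?negK // | right => X XT; rewrite H ?gf ?negK //].
Qed.

Lemma index_rev (A : eqType) (x : A) s :
  uniq s -> x \in s -> index x (rev s) = (size s).-1 - index x s.
Proof.
move=> us; rewrite -index_mem => lt.
have xE : nth x (rev s) ((size s).-1 - index x s) = x.
  rewrite nth_rev; last lia.
  have -> : size s - ((size s).-1 - index x s).+1 = index x s by lia.
  by rewrite nth_index // -index_mem.
rewrite -{1}xE index_uniq ?rev_uniq ?size_rev //; clear xE; lia.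
Qed.

Section Permutations.
Context {n : nat}.
Implicit Types (sigma tau : 'S_n) (m : substrings n) (e : pairs n).

Lemma perm_val_inj (s : 'S_n) (a b : 'I_n) : s a = s b :> nat -> a = b.
Proof. by move=> /val_inj/perm_inj. Qed.

(** Hence the inverse of [sigma] gives the position of a letter, and every sign of
    [sv_of_perm sigma] compares two positions. *)
Lemma block_index_singletons sigma a :
  block_index (singletons sigma) a = (sigma^-1)%g a.
Proof.
rewrite /block_index /singletons find_map -[RHS]index_enum_ord /index.
apply: eq_find => t /=.
by rewrite inE -[in RHS](inj_eq (@perm_inj _ sigma)) permKV eq_sym.
Qed.

Lemma sv_of_permE sigma e :
  sv_of_perm sigma e =
    if (sigma^-1)%g (val e).1 < (sigma^-1)%g (val e).2 then Pos else Neg.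
Proof.
rewrite ffunE !block_index_singletons /=; case: ltngtP => // /perm_val_inj H.
by have := valP e; rewrite /= H ltnn.
Qed.

Lemma sv_of_perm_neq0 sigma e : sv_of_perm sigma e != Zero.
Proof. by rewrite sv_of_permE; case: ifP. Qed.

Lemma revpermV sigma a : ((revperm sigma)^-1)%g a = rev_ord ((sigma^-1)%g a).
Proof.
apply: (@perm_inj _ (revperm sigma)).
by rewrite permKV /revperm permM permE rev_ordK permKV.
Qed.

Lemma ltn_rev_ord (a b : 'I_n) : (rev_ord a < rev_ord b) = (b < a).
Proof. by have := ltn_ord a; have := ltn_ord b; rewrite /=; lia. Qed.

Lemma sv_of_revperm sigma :
  sv_of_perm (revperm sigma) = oppv (sv_of_perm sigma).
Proof.
apply/ffunP => e; rewrite [RHS]ffunE !sv_of_permE !revpermV.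
rewrite ltn_rev_ord; case: (ltngtP ((sigma^-1)%g (val e).1)) => // /perm_val_inj H.
by have := valP e; rewrite /= H ltnn.
Qed.

Lemma sv_of_perm_order sigma tau :
  sv_of_perm sigma = sv_of_perm tau ->
  forall a b, ((sigma^-1)%g a < (sigma^-1)%g b) = ((tau^-1)%g a < (tau^-1)%g b).
Proof.
move=> eqst.
have lt_case (a b : 'I_n) : a < b ->
    ((sigma^-1)%g a < (sigma^-1)%g b) = ((tau^-1)%g a < (tau^-1)%g b).
  move=> ab; have := congr1 (fun X : signvec _ => X (mkpair ab)) eqst.
  by rewrite /= !sv_of_permE /=; do 2![case: ifP].
move=> a b; case: (ltngtP a b) => [/lt_case //|ba|/val_inj ->]; last by rewrite !ltnn.
have anb : a != b by apply: contraL ba => /eqP ->; rewrite ltnn.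
have nE (s : 'S_n) : (s a < s b) = ~~ (s b < s a).
  rewrite -leqNgt ltn_neqAle; case: eqP => //= /perm_val_inj eab.
  by rewrite eab eqxx in anb.
by rewrite !nE lt_case.
Qed.

Lemma sorted_word sigma :
  sorted (fun a b => (sigma^-1)%g a < (sigma^-1)%g b) (word sigma).
Proof.
rewrite /word sorted_map.
have := iota_ltn_sorted 0 n; rewrite -val_enum_ord sorted_map.
by apply: sub_sorted => a b; rewrite /= !permK.
Qed.

(** The word of a permutation lists the letters sorted by position. Equal sign vectors define the
    same strict order, and a list sorted by a strict order is determined by its elements. *)
Lemma sv_of_perm_inj : injective (@sv_of_perm n).
Proof.
move=> sigma tau eqst.
have: word sigma = word tau.
  apply: (@irr_sorted_eq _ (fun a b => (sigma^-1)%g a < (sigma^-1)%g b)).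
  - by move=> b a c; apply: ltn_trans.
  - by move=> a; apply: ltnn.
  - exact: sorted_word.
  - apply: sub_sorted (sorted_word tau) => a b.
    by rewrite (sv_of_perm_order eqst).
  - move=> a; rewrite /word -[a](permKV sigma) mem_map ?mem_enum; last exact: perm_inj.
    by rewrite permKV -[a](permKV tau) mem_map ?mem_enum //; exact: perm_inj.
by move/eq_in_map => H; apply/permP => t; apply: H; rewrite mem_enum.
Qed.

(** * Effect of a move on positions and signs *)

Lemma word_catE sigma u (w v : seq 'I_n) a :
  word sigma = u ++ w ++ v -> uniq w ->
  (a \in w -> (sigma^-1)%g a = size u + index a w :> nat) /\
  (a \notin w -> ((sigma^-1)%g a < size u) || (size u + size w <= (sigma^-1)%g a)).
Proof.
move=> E uw.
have pos : (sigma^-1)%g a = index a (word sigma) :> nat.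
  by rewrite -{2}[a](permKV sigma) index_map ?index_enum_ord //; exact: perm_inj.
have U : uniq (word sigma) by rewrite map_inj_uniq ?enum_uniq //; exact: perm_inj.
rewrite pos E !index_cat; split=> aw.
  case: ifP => [au|_]; last by rewrite aw.
  move: U; rewrite E cat_uniq => /and3P[_ /hasPn H _].
  by have := H a; rewrite mem_cat aw => /(_ isT); rewrite /= au.
case: ifP; first by rewrite -index_mem => ->.
by rewrite (negbTE aw) addnA leq_addr orbT.
Qed.

Lemma move_step_pos m sigma tau w :
  move_step m sigma tau -> w \in m -> exists p, forall a, a \in w ->
    (sigma^-1)%g a = p + index a w :> nat /\
    (tau^-1)%g a = p + ((size w).-1 - index a w) :> nat.
Proof.
move=> [[_ wf _] H _] wm; have /andP[_ uw] := wf _ wm.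
have [u [v [u' [v' [Es Et Eu]]]]] := H _ wm; exists (size u) => a aw.
have [/(_ aw) -> _] := word_catE a Es uw.
have urw : uniq (rev w) by rewrite rev_uniq.
have arw : a \in rev w by rewrite mem_rev.
have [/(_ arw) -> _] := word_catE a Et urw.
by rewrite index_rev // Eu.
Qed.

Lemma move_step_fixed m sigma tau a :
  move_step m sigma tau -> (forall w, w \in m -> a \notin w) ->
  (tau^-1)%g a = (sigma^-1)%g a.
Proof.
move=> [_ _ H] am; apply: (@perm_inj _ tau).
by rewrite permKV H ?permKV.
Qed.

(** A letter outside [w] cannot cross the interval that [w] occupies: either it is fixed, or it
    moves within another substring, whose interval is disjoint from that of [w]. *)
Lemma move_step_pos_outside m sigma tau w :
  move_step m sigma tau -> w \in m -> exists p,
    (forall a, a \in w -> p <= (sigma^-1)%g a < p + size w /\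
                          p <= (tau^-1)%g a < p + size w) /\
    (forall a, a \notin w ->
        ((sigma^-1)%g a < p) && ((tau^-1)%g a < p)
     || (p + size w <= (sigma^-1)%g a) && (p + size w <= (tau^-1)%g a)).
Proof.
move=> st wm; have [p Hp] := move_step_pos st wm; exists p.
have [[_ wf dis] _ _] := st.
split=> [a aw|a aw].
  by have [-> ->] := Hp _ aw; move: aw; rewrite -index_mem; move: (index _ _) (size _) => i k; lia.
(* Every position in the interval of a substring [v] of the move is occupied by a letter of [v]. *)
have nthpos (v : n.-bseq 'I_n) q i :
    (forall b, b \in v -> (sigma^-1)%g b = q + index b v :> nat /\
       (tau^-1)%g b = q + ((size v).-1 - index b v) :> nat) ->
    v \in m -> q <= i < q + size v -> exists2 b, b \in v & (sigma^-1)%g b = i :> nat.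
  move=> Hq vm ltq; have ltv : i - q < size v by lia.
  exists (nth a v (i - q)); first exact: mem_nth.
  have [-> _] := Hq _ (mem_nth a ltv).
  by have /andP[_ uv] := wf _ vm; rewrite index_uniq //; lia.
have [/exists_inP[v vm av]|nex] := boolP [exists v in m, a \in v]; last first.
  rewrite (move_step_fixed st); last first.
    by move=> v vm; apply: contra nex => av; apply/exists_inP; exists v.
  rewrite !andbb ltnNge -implybE; apply/implyP => pa.
  rewrite leqNgt; apply/negP => ap.
  have /(nthpos _ _ _ Hp wm)[b bw /perm_val_inj ba] :
    p <= (sigma^-1)%g a < p + size w by rewrite pa.
  by rewrite -ba bw in aw.
have [q Hq] := move_step_pos st vm.
have disj i : p <= i < p + size w -> q <= i < q + size v -> False.
  move=> /(nthpos _ _ _ Hp wm)[b bw bi] /(nthpos _ _ _ Hq vm)[c cv ci].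
  have bc : b = c by apply: (@perm_inj _ (sigma^-1)%g); apply: val_inj; rewrite /= bi ci.
  have vw : v <> w by move=> vw; rewrite -vw av in aw.
  by have /hasPn/(_ b bw) := dis _ _ vm wm vw; rewrite /= bc cv.
(* Neither interval contains the start of the other, so [v] lies wholly on one side of [w]. *)
have := disj p; have := disj q; have [-> ->] := Hq _ av; move: av.
have /andP[w2 _] := wf _ wm.
by rewrite -index_mem; move: (index _ _) (size v) (size w) w2 => i k k2; lia.
Qed.

Lemma InvP m e :
  reflect (exists2 w, w \in m & (val e).1 \in w /\ (val e).2 \in w)
          (e \in Inv m).
Proof.
rewrite inE; apply: (iffP exists_inP) => -[w wm H]; exists w => //; exact/andP.
Qed.

(** Reversal exchanges the order of two letters of one substring. If a substring contains just one
    of the two letters, the other stays on its side of it; if no substring contains either, both are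
    fixed. *)
Lemma sv_of_move_step m sigma tau :
  move_step m sigma tau ->
  sv_of_perm tau = negate_on (Inv m) (sv_of_perm sigma).
Proof.
move=> st; apply/ffunP => e; rewrite in_negate_on !sv_of_permE.
have ne : (sigma^-1)%g (val e).1 <> (sigma^-1)%g (val e).2 :> nat.
  by move=> /perm_val_inj E; have := valP e; rewrite /= E ltnn.
case: InvP => [[w wm [aw bw]]|ninv].
  have [p Hp] := move_step_pos st wm.
  move: ne; have [-> ->] := Hp _ aw; have [-> ->] := Hp _ bw.
  move: aw bw; rewrite -!index_mem.
  move: (index (val e).1 w) (index (val e).2 w) (size w) => i j k ik jk ij.
  have -> : (p + (k.-1 - i) < p + (k.-1 - j)) = ~~ (p + i < p + j) by lia.
  by case: (p + i < p + j).
have side w a b : w \in m -> a \in w -> b \notin w ->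
    ((sigma^-1)%g a < (sigma^-1)%g b) = ((tau^-1)%g a < (tau^-1)%g b) /\
    ((sigma^-1)%g b < (sigma^-1)%g a) = ((tau^-1)%g b < (tau^-1)%g a).
  move=> wm aw bw; have [p [Hin Hout]] := move_step_pos_outside st wm.
  by have := Hin _ aw; have := Hout _ bw; lia.
have [/exists_inP[w wm aw]|na] := boolP [exists w in m, (val e).1 \in w].
  have bw : (val e).2 \notin w by apply/negP => bw; apply: ninv; exists w.
  by have [-> _] := side _ _ _ wm aw bw.
have [/exists_inP[w wm bw]|nb] := boolP [exists w in m, (val e).2 \in w].
  have aw : (val e).1 \notin w by apply/negP => aw; apply: ninv; exists w.
  by have [_ ->] := side _ _ _ wm bw aw.
by rewrite !(move_step_fixed st) // => w wm; [move: nb|move: na];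
  apply: contra => aw; apply/exists_inP; exists w.
Qed.

End Permutations.

(** * From allowable graphs to sweep acycloids *)

Section AllowableToSweep.
Context {n : nat}.
Implicit Types (sigma tau : 'S_n) (m : substrings n) (e f g : pairs n).
Implicit Types (Pi : {set 'S_n}) (M : {set substrings n}).

Lemma sv_of_perm_const (sg : nat -> 'S_n) (mv : nat -> substrings n) l e :
  (forall k, k < l -> move_step (mv k) (sg k) (sg k.+1)) ->
  (forall k, k < l -> e \notin Inv (mv k)) ->
  sv_of_perm (sg l) e = sv_of_perm (sg 0) e.
Proof.
elim: l => // l IHl st ne.
rewrite (sv_of_move_step (st l (ltnSn l))) in_negate_on (negbTE (ne l _)) //.
by apply: IHl => k kl; [apply: st|apply: ne]; apply: ltnW.
Qed.

(** Disjointness of the inversion sets prevents the later moves from inverting [e] again; the tail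
    of the sequence is obtained by shifting indices with [S]. *)
Lemma sv_of_perm_flip (sg : nat -> 'S_n) (mv : nat -> substrings n) l e :
  (forall k, k < l.+1 -> move_step (mv k) (sg k) (sg k.+1)) ->
  (forall j k, j < k < l.+1 -> [disjoint Inv (mv j) & Inv (mv k)]) ->
  e \in Inv (mv 0) -> sv_of_perm (sg l.+1) e = neg (sv_of_perm (sg 0) e).
Proof.
move=> st dis e0.
rewrite (@sv_of_perm_const (sg \o S) (mv \o S) l) /=.
- by rewrite (sv_of_move_step (st 0 (ltn0Sn l))) in_negate_on e0.
- by move=> k kl; apply: st.
- by move=> k kl; have /disjointFr -> := dis 0 k.+1 kl.
Qed.

(** Each move negates both signs or neither, so whether they agree is an invariant. *)
Lemma sv_of_perm_parallel (sg : nat -> 'S_n) (mv : nat -> substrings n) l f g :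
  (forall k, k < l -> move_step (mv k) (sg k) (sg k.+1)) ->
  (forall k, k < l -> (f \in Inv (mv k)) = (g \in Inv (mv k))) ->
  (sv_of_perm (sg l) g == sv_of_perm (sg l) f) =
  (sv_of_perm (sg 0) g == sv_of_perm (sg 0) f).
Proof.
elim: l => // l IHl st ne.
rewrite (sv_of_move_step (st l (ltnSn l))) !in_negate_on ne //.
rewrite -IHl; last 2 first.
- by move=> k kl; apply: st; apply: ltnW.
- by move=> k kl; apply: ne; apply: ltnW.
by case: ifP => // _; rewrite (inj_eq (inv_inj negK)).
Qed.

Lemma neq_neg (x y : sign) : x != Zero -> y != Zero -> (x == neg y) = (x != y).
Proof. by case: x; case: y. Qed.

(** From [sigma] to [tau] a pair outside [Inv m] keeps its sign while that of [f] is negated, so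
    neither equality nor opposition holds at both. For [g] in [Inv m], (P3) makes every move on a
    sequence from [sigma] to any [rho] invert both pairs or neither, so the relation at [sigma]
    holds throughout [Pi]. *)
Lemma parclass_move Pi M m sigma tau f :
  (forall sigma tau, sigma \in Pi -> tau \in Pi ->
     exists l sg mv, allowable_sequence Pi sigma tau l sg mv /\
                     forall k, k < l -> mv k \in M) ->
  (forall m s, m \in M -> s \in M -> Inv m = Inv s \/ [disjoint Inv m & Inv s]) ->
  m \in M -> sigma \in Pi -> tau \in Pi -> move_step m sigma tau ->
  f \in Inv m -> parclass (topes_of_perms Pi) f = Inv m.
Proof.
move=> P2 P3 mM sPi tPi st fm; apply/setP => g; apply/idP/idP => [|gm].
  apply: contraTT => gm; apply/parclassP => H.
  have := sv_of_perm_neq0 sigma f; have := sv_of_perm_neq0 sigma g.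
  case: H => H; have := H _ (imset_f _ tPi); rewrite (H _ (imset_f _ sPi));
   rewrite (sv_of_move_step st) !in_negate_on fm (negbTE gm) (H _ (imset_f _ sPi));
   by case: (sv_of_perm sigma f).
have par rho : rho \in Pi ->
    (sv_of_perm rho g == sv_of_perm rho f) =
    (sv_of_perm sigma g == sv_of_perm sigma f).
  move=> rPi; have [l [sg [mv [[s0 sl _ stk _] mvM]]]] := P2 _ _ sPi rPi.
  rewrite -s0 -sl; apply: (@sv_of_perm_parallel sg mv l) => // k kl.
  have [<-|d] := P3 _ _ mM (mvM k kl); first by rewrite fm gm.
  by rewrite (disjointFr d fm) (disjointFr d gm).
apply/parclassP; have [eq|ne] := eqVneq (sv_of_perm sigma g) (sv_of_perm sigma f).
  by left => X /imsetP[rho /par parr ->]; apply/eqP; rewrite parr eq.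
right => X /imsetP[rho /par parr ->]; apply/eqP.
by rewrite neq_neg ?sv_of_perm_neq0 // parr.
Qed.

Lemma upair_InvP m (a b : 'I_n) (ab : a != b) :
  reflect (exists2 w, w \in m & a \in w /\ b \in w) (upair ab \in Inv m).
Proof.
by apply: (iffP (InvP _ _)) => -[w wm] /=; case: ifP => _ /= [aw bw]; exists w.
Qed.

(** Nonzero signs give full supports, so only equality and opposition have to be excluded. For
    letters [i < j < k] these are the two cyclic patterns. *)
Lemma orthogonal_tripleE (x y z : sign) :
  x != Zero -> y != Zero -> z != Zero ->
  orthogonal (triple x y z) (triple Pos Pos Neg) =
    ~~ [&& x == Pos, y == Pos & z == Neg] &&
    ~~ [&& x == Neg, y == Neg & z == Pos].
Proof.
move=> x0 y0 z0.
have full (u v w : sign) : u != Zero -> v != Zero -> w != Zero ->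
    supp (triple u v w) = setT.
  move=> u0 v0 w0; apply/setP => k; rewrite !inE ffunE.
  by case: k => -[|[|[|]]].
have all3 (P : pred 'I_3) : [forall k, P k] =
    [&& P ord0, P (inord 1) & P (inord 2)].
  apply/forallP/and3P => [//|[P0 P1 P2] k].
  case: k => -[|[|[|//]]] lt3.
  - by move: P0; congr P; apply: val_inj.
  - by move: P1; congr P; apply: val_inj; rewrite /= inordK.
  - by move: P2; congr P; apply: val_inj; rewrite /= inordK.
rewrite /orthogonal !full // setTI -setI_eq0 setTI.
have -> : ([set: 'I_3] == set0) = false.
  by apply/negbTE/set0Pn; exists ord0; rewrite inE.
by rewrite /= !all3 !inE !ffunE !inordK //=; case: x x0; case: y y0; case: z z0.
Qed.

Lemma two_letters (A : eqType) (s : seq A) :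
  1 < size s -> uniq s -> exists a b, [/\ a \in s, b \in s & a != b].
Proof.
case: s => [|a [|b s]] //= _ /andP[].
rewrite in_cons negb_or => /andP[ab _] _; exists a, b.
by rewrite !in_cons !eqxx orbT.
Qed.

Lemma allowable_graph_sweep_acycloid Pi :
  allowable_graph Pi -> sweep_acycloid (topes_of_perms Pi).
Proof.
move=> [M [_ P1 P2 P3]]; split.
- split.
  + move=> _ _ /imsetP[sigma _ ->] /imsetP[tau _ ->].
    by apply/setP => e; rewrite !inE !sv_of_perm_neq0.
  + by move=> _ /imsetP[sigma /P1 sPi ->]; rewrite -sv_of_revperm imset_f.
  + move=> _ _ /imsetP[sigma sPi ->] /imsetP[tau tPi ->] neq.
    have [[|l] [sg [mv [[s0 sl sPik st dis] mvM]]]] := P2 _ _ sPi tPi.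
      by case: neq; rewrite -s0 -sl.
    have [[m0 mw _] _ _] := st 0 (ltn0Sn l).
    have [f fm] : exists f, f \in Inv (mv 0).
      have /set0Pn[w wm] := m0; have /andP[w2 uw] := mw _ wm.
      have [a [b [aw bw ab]]] := two_letters w2 uw.
      by exists (upair ab); apply/upair_InvP; exists w.
    exists f.
      rewrite in_separation sv_of_perm_neq0 -s0 -sl /=.
      by rewrite (sv_of_perm_flip st dis).
    rewrite (parclass_move P2 P3 (mvM 0 (ltn0Sn l)) sPi (sPik 1 _) _ fm) //.
      by rewrite -s0 -(sv_of_move_step (st 0 _)) // imset_f // sPik.
    by rewrite -s0; apply: st.
- move=> _ i j k ij jk ik /imsetP[sigma _ ->].
  (* Either excluded pattern would order the positions of [i], [j], [k] cyclically. *)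
  rewrite orthogonal_tripleE ?sv_of_perm_neq0 // !sv_of_permE /=.
  move: (nat_of_ord ((sigma^-1)%g i)) (nat_of_ord ((sigma^-1)%g j)).
  move: (nat_of_ord ((sigma^-1)%g k)) => z x y.
  case: (ltnP x y); case: (ltnP y z); case: (ltnP x z) => // xz yz xy; exfalso; lia.
- move=> a b c ab bc ac.
  have [->|[sigma sPi]] := set_0Vmem Pi.
    by move=> _; apply/parclassP; left => X /imsetP[s]; rewrite inE.
  (* Passing from [sigma] to its reverse negates every sign, so some move on the way inverts the
     pair of [a] and [b]; its inversion set is the parallelism class in question. *)
  have [l [sg [mv [[s0 sl sPik st dis] mvM]]]] := P2 _ _ sPi (P1 _ sPi).
  have [/existsP[[k kl] /= abk]|] :=
      boolP [exists k : 'I_l, upair ab \in Inv (mv k)]; last first.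
    rewrite negb_exists => /forallP H.
    have := sv_of_perm_const st (fun k kl => H (Ordinal kl)).
    rewrite s0 sl sv_of_revperm ffunE.
    by have := sv_of_perm_neq0 sigma (upair ab); case: (sv_of_perm _ _).
  rewrite (parclass_move P2 P3 (mvM k kl) (sPik k (ltnW kl)) (sPik _ kl) (st k kl)) //.
  move=> /upair_InvP[w wm [bw cw]]; apply/upair_InvP.
  have /upair_InvP[w' wm' [aw bw']] := abk.
  have [[_ _ disw] _ _] := st k kl.
  (* Two substrings of one move that share the letter [b] are equal. *)
  exists w => //; split=> //; have [->//|/eqP ww'] := eqVneq w w'.
  by have /hasPn/(_ b bw') := disw _ _ wm wm' ww'; rewrite /= bw.
Qed.

End AllowableToSweep.

(** * Sign vectors as relations on letters *)

Section Signs.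
Context {n : nat}.
Implicit Types (a b c : 'I_n) (X : signvec (pairs n)) (F : {set pairs n}).
Implicit Types (sigma tau : 'S_n).

(** Antisymmetric extension of [X] to all ordered pairs, so that later arguments need not know which
    letter is smaller. *)
Definition sgn X a b : sign :=
  if insub (a, b) : option (pairs n) is Some e then X e
  else if insub (b, a) : option (pairs n) is Some e then neg (X e)
  else Zero.

(** The value on the diagonal is [true], so that a parallelism class of a sweep acycloid gives an
    equivalence relation. *)
Definition linked F a b : bool :=
  if insub (a, b) : option (pairs n) is Some e then e \in F
  else if insub (b, a) : option (pairs n) is Some e then e \in F
  else true.

Variant pair_spec a b : option (pairs n) -> option (pairs n) -> Type :=
| PairLt (ab : a < b) : pair_spec a b (Some (mkpair ab)) None
| PairGt (ba : b < a) : pair_spec a b None (Some (mkpair ba))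
| PairEq (ab : a = b) : pair_spec a b None None.

Lemma insub_mkpair a b (ab : a < b) :
  insub (a, b) = Some (mkpair ab) :> option (pairs n).
Proof.
case: insubP => [e _ vale|]; last by rewrite /= ab.
by congr Some; apply: val_inj; rewrite vale.
Qed.

Lemma insub_geq a b : b <= a -> insub (a, b) = None :> option (pairs n).
Proof. by move=> ba; case: insubP => //= e; rewrite ltnNge ba. Qed.

Lemma insub_pairP a b : pair_spec a b (insub (a, b)) (insub (b, a)).
Proof.
case: (ltngtP a b) => [ab|ba|/val_inj ->].
- by rewrite (insub_mkpair ab) (insub_geq (ltnW ab)); apply: PairLt.
- by rewrite (insub_mkpair ba) (insub_geq (ltnW ba)); apply: PairGt.
- by rewrite (insub_geq (leqnn b)); apply: PairEq.
Qed.

Lemma sgnN X a b : sgn X b a = neg (sgn X a b).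
Proof. by rewrite /sgn; case: (insub_pairP a b) => [lt|lt|_] /=; rewrite ?negK. Qed.

Lemma sgn_mkpair X a b (ab : a < b) : sgn X a b = X (mkpair ab).
Proof.
rewrite /sgn; case: (insub_pairP a b) => [ab'|ba|eab].
- by rewrite (bool_irrelevance ab ab').
- by have := ab; rewrite ltnNge ltnW.
- by exfalso; move: ab; rewrite eab ltnn.
Qed.

Lemma sgn_pair X (e : pairs n) : sgn X (val e).1 (val e).2 = X e.
Proof. by case: e => -[a b] ab; rewrite -sgn_mkpair. Qed.

Lemma sgn_eq0 X a b :
  supp X = [set: pairs n] -> (sgn X a b == Zero) = (a == b).
Proof.
move=> /setP full.
have X0 e : X e != Zero by have := full e; rewrite !inE.
rewrite /sgn; case: (insub_pairP a b) => [ab|ba|->]; last by rewrite !eqxx.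
- by rewrite (negbTE (X0 _)) -val_eqE ltn_eqF.
- by have := X0 (mkpair ba); rewrite -val_eqE gtn_eqF //; case: (X _).
Qed.

Lemma sgn_sv_of_partition (I : seq {set 'I_n}) a b :
  sgn (sv_of_partition I) a b =
    if block_index I a < block_index I b then Pos
    else if block_index I b < block_index I a then Neg else Zero.
Proof.
rewrite /sgn; case: (insub_pairP a b) => [ab|ba|->]; rewrite ?ltnn // ffunE /=;
  by case: ltngtP.
Qed.

Lemma sgn_sv_of_perm sigma a b :
  sgn (sv_of_perm sigma) a b =
    if (sigma^-1)%g a < (sigma^-1)%g b then Pos
    else if (sigma^-1)%g b < (sigma^-1)%g a then Neg else Zero.
Proof. by rewrite sgn_sv_of_partition !block_index_singletons. Qed.

Lemma sgn_Pos sigma a b :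
  (sgn (sv_of_perm sigma) a b == Pos) = ((sigma^-1)%g a < (sigma^-1)%g b).
Proof. by rewrite sgn_sv_of_perm; case: ltngtP. Qed.

Lemma linked_refl F : reflexive (linked F).
Proof. by move=> a; rewrite /linked insub_geq. Qed.

Lemma linked_sym F : symmetric (linked F).
Proof. by move=> a b; rewrite /linked; case: (insub_pairP a b). Qed.

Lemma linked_pair F (e : pairs n) : linked F (val e).1 (val e).2 = (e \in F).
Proof.
case: e => -[a b] /= ab; rewrite /linked; case: (insub_pairP a b) => [ab'|ba|eab].
- by rewrite (bool_irrelevance ab ab').
- by have := ab; rewrite ltnNge ltnW.
- by exfalso; move: ab; rewrite eab ltnn.
Qed.

Lemma linked_upair F a b (ab : a != b) : linked F a b = (upair ab \in F).
Proof.
by rewrite -linked_pair /=; case: ifP => // _; rewrite linked_sym.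
Qed.

Lemma sgn_negate_on F X a b :
  sgn (negate_on F X) a b =
    if linked F a b then neg (sgn X a b) else sgn X a b.
Proof. by rewrite /sgn /linked; case: (insub_pairP a b) => // ?; rewrite ffunE; case: ifP. Qed.

(** For distinct letters this is condition (ii), once [parclass_eq] has made the pair of [a] and [b]
    the representative of the class. *)
Lemma linked_trans (T : {set signvec (pairs n)}) f :
  sweep_acycloid T -> transitive (linked (parclass T f)).
Proof.
move=> [_ _ H] b a c.
have [->//|ab] := eqVneq a b.
have [->//|bc] := eqVneq b c.
have [->|ac] := eqVneq a c; first by rewrite linked_refl.
rewrite !linked_upair => /parclass_eq <- bc_ab; exact: H bc_ab.
Qed.

(** A failure of transitivity is a cyclic triple, which condition (i) forbids. That condition speaks
    of increasing letters only, hence the case analysis on the order of [a], [b], [c]. *)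
Lemma sgn_trans (T : {set signvec (pairs n)}) X a b c :
  sweep_acycloid T -> X \in T -> supp X = [set: pairs n] ->
  sgn X a b = Pos -> sgn X b c = Pos -> sgn X a c = Pos.
Proof.
move=> [_ H _] XT full ab bc.
have key (i j k : 'I_n) : i < j -> j < k ->
    ~~ [&& sgn X i j == Pos, sgn X j k == Pos & sgn X i k == Neg] &&
    ~~ [&& sgn X i j == Neg, sgn X j k == Neg & sgn X i k == Pos].
  move=> ij jk; have ik := ltn_trans ij jk.
  rewrite -orthogonal_tripleE ?sgn_eq0 //; last first.
  - by rewrite -val_eqE ltn_eqF.
  - by rewrite -val_eqE ltn_eqF.
  - by rewrite -val_eqE ltn_eqF.
  by rewrite !sgn_mkpair H.
have nab : a != b by rewrite -(sgn_eq0 _ _ full) ab.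
have nbc : b != c by rewrite -(sgn_eq0 _ _ full) bc.
have nac : a != c by apply: contra_eqN bc => /eqP <-; rewrite sgnN ab.
have := nac; rewrite -(sgn_eq0 _ _ full).
have ba := sgnN X a b; have cb := sgnN X b c; have ca := sgnN X a c.
rewrite ab bc /= in ba cb.
move: nab nbc nac; rewrite -!val_eqE /= !neq_ltn.
(* Of the eight combinations, six are the orders of the three letters and two are contradictory. *)
case/orP => lab; case/orP => lbc; case/orP => lac.
- by have := key _ _ _ lab lbc; rewrite ab bc; case: (sgn X a c).
- by have := ltn_trans lab lbc; rewrite ltnNge ltnW.
- by have := key _ _ _ lac lbc; rewrite cb ab; case: (sgn X a c).
- by have := key _ _ _ lac lab; rewrite ca cb ab; case: (sgn X a c).
- by have := key _ _ _ lab lac; rewrite ba bc; case: (sgn X a c).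
- by have := key _ _ _ lbc lac; rewrite ca ba bc; case: (sgn X a c).
- by have := ltn_trans lac lbc; rewrite ltnNge ltnW.
- by have := key _ _ _ lbc lab; rewrite cb ba ca; case: (sgn X a c).
Qed.

End Signs.

(** * Permutations from topes *)

Section Topes.
Context {n : nat}.
Implicit Types (a b c : 'I_n) (X : signvec (pairs n)) (F : {set pairs n}).
Implicit Types (sigma tau : 'S_n) (I : seq {set 'I_n}).

Lemma ordered_partition_singletons sigma : ordered_partition (singletons sigma).
Proof.
apply/andP; split.
  rewrite map_inj_uniq ?enum_uniq // => s t /set1_inj.
  exact: perm_inj.
have single B : B \in [set B in singletons sigma] -> exists a, B = [set a].
  by rewrite inE => /mapP[t _ ->]; exists (sigma t).
apply/and3P; split.
- apply/eqP/setP => a; rewrite inE; apply/bigcupP; exists [set a]; rewrite ?inE //.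
  apply/mapP; exists ((sigma^-1)%g a); first by rewrite mem_enum.
  by rewrite permKV.
- apply/trivIsetP => _ _ /single[a ->] /single[b ->] ab.
  by rewrite disjoints1 inE; apply: contra ab => /eqP ->.
- by apply/negP => /single[a] /setP/(_ a); rewrite !inE eqxx.
Qed.

Lemma block_index_lt I a : ordered_partition I -> block_index I a < size I.
Proof.
move=> /andP[_ /and3P[/eqP cov _ _]].
have : a \in cover [set B in I] by rewrite cov inE.
move=> /bigcupP[B]; rewrite inE => BI aB.
by rewrite /block_index -has_find; apply/hasP; exists B.
Qed.

Lemma mem_nth_block I k a :
  ordered_partition I -> k < size I ->
  (a \in nth set0 I k) = (block_index I a == k).
Proof.
move=> opI kI; have aI := block_index_lt a opI.
have afind : a \in nth set0 I (block_index I a).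
  have hasa : has (fun B : {set 'I_n} => a \in B) I by rewrite has_find.
  exact: (nth_find set0 hasa).
apply/idP/eqP => [ak|<-] //.
have /andP[uI /and3P[_ /trivIsetP tI _]] := opI.
apply/eqP; rewrite -(nth_uniq set0 aI kI uI).
apply: contraLR ak => ne.
by rewrite (disjointFr (tI _ _ _ _ ne) afind) // inE mem_nth.
Qed.

(** Along the word of [sigma] the block indices strictly increase, and since no block is empty they
    take every value below [size I]. They are therefore [0, 1, ...] in order, and block [t] is the
    singleton of [sigma t]. *)
Lemma partition_of_unique I sigma :
  partition_of (sv_of_perm sigma) I -> I = singletons sigma.
Proof.
move=> /andP[opI /eqP svI].
have lt_block a b :
    (block_index I a < block_index I b) = ((sigma^-1)%g a < (sigma^-1)%g b).
  by rewrite -sgn_Pos -svI sgn_sv_of_partition; do 2?case: ifP.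
have idx : [seq block_index I a | a <- word sigma] = iota 0 (size I).
  apply: (irr_sorted_eq ltn_trans ltnn); last 2 first.
  - exact: iota_ltn_sorted.
  - move=> k; rewrite mem_iota /= add0n; apply/mapP/idP => [[a _ ->]|kI].
      exact: block_index_lt.
    have /andP[_ /and3P[_ _ n0]] := opI.
    have : nth set0 I k != set0.
      by apply: contra n0 => /eqP <-; rewrite inE mem_nth.
    case/set0Pn => a; rewrite mem_nth_block // => /eqP <-; exists a => //.
    apply/mapP; exists ((sigma^-1)%g a); first by rewrite mem_enum.
    by rewrite permKV.
  rewrite sorted_map; apply: sub_sorted (sorted_word sigma) => a b /=.
  by rewrite lt_block.
have sizeI : size I = n.
  have := congr1 size idx; rewrite /word 2!size_map; by rewrite size_enum_ord size_iota.
have block_perm t : block_index I (sigma t) = t.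
  have := congr1 (fun s => nth 0 s t) idx.
  rewrite -map_comp (nth_map t) ?size_enum_ord //.
  by rewrite nth_ord_enum nth_iota ?sizeI.
apply: (@eq_from_nth _ set0); first by rewrite size_map size_enum_ord.
rewrite sizeI => k kn; rewrite (nth_map (Ordinal kn)) ?size_enum_ord //.
have -> : nth (Ordinal kn) (enum 'I_n) k = Ordinal kn := nth_ord_enum _ (Ordinal kn).
apply/setP => a; rewrite mem_nth_block ?sizeI // inE.
rewrite -{1}[a](permKV sigma) block_perm.
by rewrite -[k]/(val (Ordinal kn)) val_eqE -[in LHS](inj_eq (@perm_inj _ sigma)) permKV.
Qed.

Lemma partition_of_singletons sigma X :
  partition_of X (singletons sigma) = (sv_of_perm sigma == X).
Proof. by rewrite /partition_of ordered_partition_singletons. Qed.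

Lemma in_perms_of_topes (T : {set signvec (pairs n)}) sigma :
  (sigma \in perms_of_topes T) = (sv_of_perm sigma \in T).
Proof.
rewrite inE; apply/exists_inP/idP => [[X XT]|sT].
  by rewrite partition_of_singletons => /eqP ->.
by exists (sv_of_perm sigma); rewrite ?partition_of_singletons.
Qed.

(** The tournament [sgn X] is transitive, so the number of letters below a letter increases strictly
    along it. These ranks are the positions in the required permutation. *)
Lemma tope_perm (T : {set signvec (pairs n)}) X :
  sweep_acycloid T -> X \in T -> supp X = [set: pairs n] ->
  exists sigma, sv_of_perm sigma = X.
Proof.
move=> swT XT full.
pose below a := [set b | sgn X b a == Pos].
have notin a : a \notin below a.
  have /eqP := sgn_eq0 a a full.
  by rewrite inE; case: (sgn X a a); rewrite eqxx.
have ltb a : #|below a| < n.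
  rewrite -[ltnRHS]card_ord -cardsT; apply: proper_card.
  by rewrite properE subsetT; apply/subsetPn; exists a.
have mono a b : sgn X a b = Pos -> #|below a| < #|below b|.
  move=> ab; apply: proper_card; apply/properP; split.
    apply/subsetP => c; rewrite !inE => /eqP ca; apply/eqP.
    exact: (sgn_trans swT XT full ca ab).
  by exists a; rewrite // inE ab.
have tot a b : a != b -> sgn X a b = Pos \/ sgn X b a = Pos.
  by rewrite -(sgn_eq0 _ _ full) (sgnN X a b); case: sgn; auto.
have rinj : injective (fun a => Ordinal (ltb a)).
  move=> a b /(congr1 val) /= rab; apply/eqP; case: eqVneq => // /tot.
  by case=> /mono; rewrite rab ltnn.
exists ((perm rinj)^-1)%g; apply/ffunP => e.
rewrite sv_of_permE invgK !permE /= -sgn_pair.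
have ne : (val e).1 != (val e).2.
  by have := valP e; rewrite -val_eqE => /ltn_eqF ->.
have [H|H] := tot _ _ ne; first by rewrite H mono.
by rewrite sgnN H ltnNge ltnW ?mono.
Qed.

Lemma parclass_sub_separation (T : {set signvec (pairs n)}) X Y f :
  X \in T -> Y \in T -> (forall X, X \in T -> supp X = [set: pairs n]) ->
  f \in separation X Y -> parclass T f \subset separation X Y.
Proof.
move=> XT YT full; rewrite in_separation => /andP[_ /eqP fY].
apply/subsetP => g /parclassP gf; rewrite in_separation.
have /setP/(_ g) := full _ XT; rewrite !inE => -> /=; apply/eqP.
by case: gf => H; rewrite !H // fY.
Qed.

End Topes.

(** * Reversal of parallel blocks *)

Section BlockReversal.
Context (n : nat) (sigma tau : 'S_n) (F : {set pairs n}).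
Context (Ftrans : transitive (linked F)).
Context (svF : sv_of_perm tau = negate_on F (sv_of_perm sigma)).
Implicit Types (s t u : 'I_n).

(** Linkage is read on the positions of [sigma], where its classes turn out to be intervals. *)
Definition lpos s t := linked F (sigma s) (sigma t).

Lemma lpos_refl s : lpos s s. Proof. exact: linked_refl. Qed.

Lemma lpos_sym s t : lpos s t = lpos t s. Proof. exact: linked_sym. Qed.

Lemma lpos_trans t s u : lpos s t -> lpos t u -> lpos s u.
Proof. exact: Ftrans. Qed.

(* If s < t < u with s, u linked but not t, then tau keeps the relative order
   of s, t and of t, u, yet exchanges that of s and u. *)
Lemma lpos_convex s t u : s <= t <= u -> lpos s u -> lpos s t.
Proof.
case/andP; rewrite leq_eqVlt => /orP[/eqP/val_inj-> _ _|st]; first exact: lpos_refl.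
rewrite leq_eqVlt => /orP[/eqP/val_inj-> //|tu] su.
apply/negPn/negP => nst.
have ntu : ~~ lpos t u.
  by apply: contra nst => tu'; rewrite (lpos_trans su) // lpos_sym.
have order x y : ((tau^-1)%g (sigma x) < (tau^-1)%g (sigma y)) =
    (if lpos x y then y < x else x < y).
  rewrite -sgn_Pos svF sgn_negate_on -/(lpos x y) sgn_sv_of_perm !permK.
  by case: (lpos x y); case: ltngtP.
have st' : (tau^-1)%g (sigma s) < (tau^-1)%g (sigma t) by rewrite order (negbTE nst).
have tu' : (tau^-1)%g (sigma t) < (tau^-1)%g (sigma u) by rewrite order (negbTE ntu).
by have := ltn_trans st' tu'; rewrite order su ltnNge ltnW // (ltn_trans st).
Qed.

(** * Intervals of linked positions and their reflections *)

Definition lo t : 'I_n := [arg min_(s < t | lpos t s) (s : nat)].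
Definition hi t : 'I_n := [arg max_(s > t | lpos t s) (s : nat)].

Lemma loP t : lpos t (lo t) /\ forall s, lpos t s -> lo t <= s.
Proof. by rewrite /lo; case: arg_minnP => [|s ts H]; rewrite ?lpos_refl. Qed.

Lemma hiP t : lpos t (hi t) /\ forall s, lpos t s -> s <= hi t.
Proof. by rewrite /hi; case: arg_maxnP => [|s ts H]; rewrite ?lpos_refl. Qed.

Lemma lo_hi t : lo t <= t <= hi t.
Proof. by rewrite (loP t).2 ?(hiP t).2 ?lpos_refl. Qed.

Lemma mem_block t s : (lo t <= s <= hi t) = lpos t s.
Proof.
apply/idP/idP => [lsh|ts]; last by rewrite (loP t).2 ?(hiP t).2.
have [lt _] := loP t; have [ht _] := hiP t.
apply: (lpos_trans lt); apply: (lpos_convex lsh).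
by apply: lpos_trans ht; rewrite lpos_sym.
Qed.

Lemma lo_eq s t : lpos s t -> lo s = lo t.
Proof.
move=> st; have ts : lpos t s by rewrite lpos_sym.
have [ls mins] := loP s; have [lt mint] := loP t.
apply: val_inj; apply/eqP; rewrite eqn_leq.
by rewrite (mins _ (lpos_trans st lt)) (mint _ (lpos_trans ts ls)).
Qed.

Lemma hi_eq s t : lpos s t -> hi s = hi t.
Proof.
move=> st; have ts : lpos t s by rewrite lpos_sym.
have [hs maxs] := hiP s; have [ht maxt] := hiP t.
apply: val_inj; apply/eqP; rewrite eqn_leq.
by rewrite (maxs _ (lpos_trans st ht)) (maxt _ (lpos_trans ts hs)).
Qed.

Lemma mirror_subproof t : lo t + hi t - t < n.
Proof. by have := lo_hi t; have := ltn_ord (hi t); lia. Qed.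

Definition mirror t : 'I_n := Ordinal (mirror_subproof t).

Lemma lpos_mirror t : lpos t (mirror t).
Proof. by rewrite -mem_block /=; have := lo_hi t; lia. Qed.

Lemma mirrorK : involutive mirror.
Proof.
move=> t; apply: val_inj => /=.
rewrite -(lo_eq (lpos_mirror t)) -(hi_eq (lpos_mirror t)).
by have := lo_hi t; lia.
Qed.

(** Within a class the reflection reverses order. Distinct classes are disjoint intervals, each
    mapped to itself, so order between them is kept. *)
Lemma ltn_mirror s t : s < t -> (mirror s < mirror t) = ~~ lpos s t.
Proof.
move=> st; have := lo_hi s; have := lo_hi t.
have [lst|nst] := boolP (lpos s t).
  by rewrite /= (lo_eq lst) (hi_eq lst); lia.
suff: hi s < lo t by rewrite /=; lia.
rewrite ltnNge; apply: contra nst => lohi.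
have [lt _] := loP t.
(* If the intervals overlapped, then [s] would lie in that of [t], or [lo t] in that of [s]. *)
have [ls|sl] := leqP (lo t) s.
  by rewrite lpos_sym -mem_block ls (leq_trans (ltnW st)) //; have /andP[] := lo_hi t.
have slo : lpos s (lo t).
  by rewrite -mem_block lohi andbT; have /andP[/leq_trans-> //] := lo_hi s; exact: ltnW.
by apply: (lpos_trans slo); rewrite lpos_sym.
Qed.

(** A permutation is determined by its sign vector, and by [ltn_mirror] reflecting the positions of
    [sigma] negates exactly the signs of the linked pairs, as [svF] prescribes for [tau]. *)
Lemma tau_mirror t : tau t = sigma (mirror t).
Proof.
suff -> : tau = (perm (inv_inj mirrorK) * sigma)%g by rewrite permM permE.
apply: sv_of_perm_inj; rewrite svF; apply/ffunP => e.
set rho := (perm _ * sigma)%g.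
have posE a : (rho^-1)%g a = mirror ((sigma^-1)%g a).
  by apply: (@perm_inj _ rho); rewrite permKV permM permE mirrorK permKV.
rewrite in_negate_on !sv_of_permE !posE -linked_pair.
have -> : linked F (val e).1 (val e).2 =
    lpos ((sigma^-1)%g (val e).1) ((sigma^-1)%g (val e).2).
  by rewrite /lpos !permKV.
have: (sigma^-1)%g (val e).1 <> (sigma^-1)%g (val e).2.
  by move=> /perm_inj E; have := valP e; rewrite /= E ltnn.
move: ((sigma^-1)%g _) ((sigma^-1)%g _) => u s nsu.
case: (ltngtP s u) => [su|us|/val_inj //].
  by rewrite ltn_mirror //; case: lpos.
have := ltn_mirror us; rewrite lpos_sym.
case: (ltngtP (mirror s) (mirror u)) => [_|_|/val_inj/(inv_inj mirrorK)//].
  by case: lpos.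
by case: lpos.
Qed.

(** * The intervals as substrings of a move *)

Definition blen t := (hi t - lo t).+1.
(** The interval is computed from [sigma], while [s] is free so that the same positions can be read
    in [tau]. *)
Definition bseg (s : 'S_n) t := take (blen t) (drop (lo t) (word s)).

Lemma size_word (s : 'S_n) : size (word s) = n.
Proof. by rewrite size_map size_enum_ord. Qed.

Lemma lo_blen t : lo t + blen t <= n.
Proof. by have := ltn_ord (hi t); have := lo_hi t; rewrite /blen; lia. Qed.

Lemma size_bseg (p : 'S_n) t : size (bseg p t) = blen t.
Proof.
by rewrite size_take size_drop size_word; have := lo_blen t; case: ltngtP; lia.
Qed.

Lemma word_bseg (s : 'S_n) t :
  word s = take (lo t) (word s) ++ bseg s t ++ drop (blen t) (drop (lo t) (word s)).
Proof. by rewrite /bseg !cat_take_drop. Qed.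

Lemma uniq_bseg (p : 'S_n) t : uniq (bseg p t).
Proof.
by apply/take_uniq/drop_uniq; rewrite map_inj_uniq ?enum_uniq //; exact: perm_inj.
Qed.

Lemma mem_bseg t a : (a \in bseg sigma t) = lpos t ((sigma^-1)%g a).
Proof.
rewrite -mem_block; have [Hin Hout] := word_catE a (word_bseg sigma t) (uniq_bseg sigma t).
have sizelo : size (take (lo t) (word sigma)) = lo t.
  by rewrite size_takel // size_word ltnW.
rewrite sizelo size_bseg in Hin Hout.
have := lo_hi t; have [aw|aw] := boolP (a \in bseg sigma t).
  have := aw; rewrite (Hin aw) -index_mem size_bseg /blen.
  by move: (index _ _) => i; lia.
by have := Hout aw; rewrite /blen; lia.
Qed.

Lemma nth_bseg (s : 'S_n) a t i (lt : lo t + i < n) :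
  i < blen t -> nth a (bseg s t) i = s (Ordinal lt).
Proof.
move=> ilt; rewrite nth_take // nth_drop (nth_map (Ordinal lt)) ?size_enum_ord //.
by congr (s _); apply: val_inj; rewrite /= nth_enum_ord.
Qed.

Lemma bseg_rev t : bseg tau t = rev (bseg sigma t).
Proof.
apply: (@eq_from_nth _ t); first by rewrite size_rev !size_bseg.
move=> i; rewrite size_bseg => ib; have lb := lo_blen t.
rewrite nth_rev ?size_bseg //.
have lt1 : lo t + i < n by lia.
have lt2 : lo t + (blen t - i.+1) < n by lia.
rewrite (nth_bseg _ _ lt1) // (nth_bseg _ _ lt2) ?tau_mirror; last by lia.
congr (sigma _); apply: val_inj => /=.
(* The position [lo t + i] has the same interval as [t], so its mirror image can be computed with
   [lo t] and [hi t]. *)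
have tt' : lpos t (Ordinal lt1).
  by rewrite -mem_block /=; move: ib; rewrite /blen; have := lo_hi t; lia.
rewrite -(lo_eq tt') -(hi_eq tt'); move: ib; rewrite /blen; have := lo_hi t; lia.
Qed.

(** The default of [insub_bseq] is never reached, because the interval has at most [n] positions. *)
Definition block_word t : n.-bseq 'I_n := insub_bseq n (bseg sigma t).

Lemma block_wordE t : block_word t = bseg sigma t :> seq 'I_n.
Proof.
apply: insubdK; rewrite unfold_in size_bseg.
by have := lo_blen t; lia.
Qed.

Lemma mem_block_word t a : (a \in block_word t) = lpos t ((sigma^-1)%g a).
Proof. by rewrite -mem_bseg -block_wordE. Qed.

(** Classes with a single position are left out, since a substring of a move has length at least
    2. *)
Definition block_move : substrings n := [set block_word t | t in [set t | lo t < hi t]].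

(** Two letters share a block word exactly when their positions are linked, and a class with two
    distinct positions is among those retained. *)
Lemma Inv_block_move : Inv block_move = F.
Proof.
apply/setP => e; apply/idP/idP.
  rewrite -(linked_pair F) => /InvP[w /imsetP[t _ ->]]; rewrite !mem_block_word => -[ta tb].
  by move: (lpos_trans (etrans (lpos_sym _ _) ta) tb); rewrite /lpos !permKV.
rewrite -(linked_pair F); set s := (sigma^-1)%g (val e).1; set t := (sigma^-1)%g (val e).2.
have -> : linked F (val e).1 (val e).2 = lpos s t by rewrite /lpos !permKV.
move=> st; apply/InvP; exists (block_word s); last by rewrite !mem_block_word lpos_refl.
apply: imset_f; rewrite inE.
have := lo_hi s; have : lo s <= t <= hi s by rewrite mem_block.
have : s <> t :> nat.
  by move=> /perm_val_inj E; have := valP e; rewrite /= E ltnn.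
by lia.
Qed.

Lemma is_move_block_move : F != set0 -> is_move block_move.
Proof.
move=> Fn0; split.
- apply: contraNneq Fn0 => m0; rewrite -Inv_block_move m0.
  by apply/eqP/setP => e; rewrite in_set0; apply/negbTE/InvP => -[w wm _]; rewrite in_set0 in wm.
- move=> w /imsetP[t]; rewrite inE => lt ->.
  by rewrite block_wordE uniq_bseg size_bseg /blen andbT; lia.
- move=> _ _ /imsetP[s _ ->] /imsetP[t _ ->] ne.
  apply/hasPn => a; rewrite /= !mem_block_word => ta.
  apply/negP => sa; apply: ne.
  have st : lpos s t by apply: lpos_trans sa _; rewrite lpos_sym.
  by rewrite /block_word /bseg /blen (lo_eq st) (hi_eq st).
Qed.

(** Each interval is reversed by [bseg_rev]; a position outside all retained intervals forms a class
    by itself and is fixed by [mirror]. *)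
Lemma move_step_block_move : F != set0 -> move_step block_move sigma tau.
Proof.
move=> Fn0; split; first exact: is_move_block_move.
- move=> _ /imsetP[t _ ->]; rewrite block_wordE -bseg_rev.
  do 4 eexists; split; [exact: word_bseg|exact: word_bseg|].
  by rewrite !size_takel // size_word ltnW.
- move=> t H; rewrite tau_mirror; congr (sigma _); apply: val_inj => /=.
  have := lo_hi t; have [lt|] := ltnP (lo t) (hi t); last by lia.
  have : block_word t \in block_move by apply: imset_f; rewrite inE.
  by move/H; rewrite mem_block_word permK lpos_refl.
Qed.

End BlockReversal.

(** * From sweep acycloids to allowable graphs *)

Section SweepToAllowable.
Context {n : nat}.
Implicit Types (sigma tau : 'S_n) (T : {set signvec (pairs n)}).

(** A boolean form of [is_move], needed to collect moves in a finite set. *)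
Definition is_moveb (m : substrings n) : bool :=
  [&& m != set0,
      [forall w in m, (2 <= size w) && uniq w]
    & [forall v in m, forall w in m, (v != w) ==> ~~ has [in v] w]].

Lemma is_moveP m : reflect (is_move m) (is_moveb m).
Proof.
apply: (iffP and3P) => -[m0 mw md]; split=> //.
- by move=> w wm; move/forall_inP: mw; apply.
- move=> v w vm wm /eqP vw.
  by have /forall_inP/(_ v vm)/forall_inP/(_ w wm)/implyP := md; apply.
- exact/forall_inP.
- by apply/forall_inP => v vm; apply/forall_inP => w wm; apply/implyP => /eqP; apply: md.
Qed.

(** Parallelism classes are equal or disjoint, so this choice of moves yields (P3). *)
Definition tope_moves T : {set substrings n} :=
  [set m | is_moveb m & [exists f, Inv m == parclass T f]].

(** Induction on the size of the separation set. The last clause, that moves invert only separated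
    pairs, is what makes the first move disjoint from those supplied by the induction hypothesis. *)
Lemma sweep_path T sigma tau :
  sweep_acycloid T -> (forall X, X \in T -> supp X = [set: pairs n]) ->
  sv_of_perm sigma \in T -> sv_of_perm tau \in T ->
  exists l sg mv,
    [/\ allowable_sequence (perms_of_topes T) sigma tau l sg mv,
        forall k, k < l -> mv k \in tope_moves T
      & forall k, k < l ->
          Inv (mv k) \subset separation (sv_of_perm sigma) (sv_of_perm tau)].
Proof.
move=> swT full sT tT; have [[_ _ T3] _ _] := swT.
have [d] := ubnP #|separation (sv_of_perm sigma) (sv_of_perm tau)|.
elim: d sigma sT => // d IHd sigma sT leD.
have [/sv_of_perm_inj st|/eqP ne] := eqVneq (sv_of_perm sigma) (sv_of_perm tau).
  exists 0, (fun _ => sigma), (fun _ => set0); split=> //; split=> //.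
  - by move=> k _; rewrite in_perms_of_topes.
  - by move=> j k; rewrite ltn0 andbF.
have [f fS negT] := T3 _ _ sT tT ne.
have [rho rhoE] := tope_perm swT negT (full _ negT).
rewrite -rhoE in negT.
pose F := parclass T f; have subF := parclass_sub_separation sT tT full fS.
have Fn0 : F != set0 by apply/set0Pn; exists f; apply: parclass_refl.
have Ftr : transitive (linked F) by exact: linked_trans.
(* The first move, from [sigma] to [rho], removes exactly the class [F] from the separation set. *)
have sep : separation (sv_of_perm rho) (sv_of_perm tau) =
    separation (sv_of_perm sigma) (sv_of_perm tau) :\: F.
  apply/setP => e; rewrite in_setD !in_separation !sv_of_perm_neq0 /= rhoE in_negate_on.
  have [eF|//] := boolP (e \in F).
  have := subsetP subF _ eF; rewrite in_separation => /andP[_ /eqP ->].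
  by case: (sv_of_perm sigma e) (sv_of_perm_neq0 sigma e).
have [|l [sg [mv [[s0 sl sPi st dis] mvM mvS]]]] := IHd rho negT.
  rewrite sep -ltnS; apply: leq_trans leD; apply: proper_card; apply/properP.
  split; first exact: subsetDl.
  by exists f => //; rewrite in_setD parclass_refl.
exists l.+1, (fun k => if k is k'.+1 then sg k' else sigma),
  (fun k => if k is k'.+1 then mv k' else block_move sigma F).
have mvF k : k < l -> [disjoint F & Inv (mv k)].
  move=> kl; rewrite disjoint_sym; apply: disjointWl (mvS k kl) _.
  by rewrite sep disjoint_sym disjoints_subset; apply/subsetP => e eF; rewrite in_setC in_setD eF.
split.
- split=> //.
  + by case=> [|k] kl; [rewrite in_perms_of_topes | apply: sPi].
  + case=> [|k] kl; last exact: st.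
    by rewrite s0; apply: move_step_block_move.
  + move=> [|j] [|k] //= jkl; last exact: dis.
    by rewrite (Inv_block_move Ftr rhoE) mvF.
- case=> [|k] kl; last exact: mvM.
  rewrite inE; apply/andP; split.
    exact/is_moveP/(is_move_block_move Ftr rhoE).
  by apply/existsP; exists f; rewrite (Inv_block_move Ftr rhoE).
- case=> [|k] kl; first by rewrite (Inv_block_move Ftr rhoE).
  by apply: subset_trans (mvS k kl) _; rewrite sep subsetDl.
Qed.

Lemma sweep_acycloid_allowable_graph T :
  sweep_acycloid T -> (forall X, X \in T -> supp X = [set: pairs n]) ->
  allowable_graph (perms_of_topes T).
Proof.
move=> swT full; exists (tope_moves T); split.
- by move=> m; rewrite inE => /andP[/is_moveP].
- move=> sigma; rewrite !in_perms_of_topes sv_of_revperm.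
  by have [[_ T2 _] _ _] := swT; apply: T2.
- move=> sigma tau; rewrite !in_perms_of_topes => sT tT.
  by have [l [sg [mv [seq mvM _]]]] := sweep_path swT full sT tT; exists l, sg, mv.
- move=> m s; rewrite !inE => /andP[_ /existsP[f /eqP ->]] /andP[_ /existsP[g /eqP ->]].
  (* Two classes with a common element [h] both equal the class of [h]. *)
  have [|nd] := boolP [disjoint parclass T f & parclass T g]; first by right.
  rewrite -setI_eq0 in nd; have /set0Pn[h] := nd; rewrite in_setI => /andP[hf hg].
  by left; rewrite -(parclass_eq hf) (parclass_eq hg).
Qed.

End SweepToAllowable.

Theorem theorem7p16 (n : nat) :
  (forall Pi : {set 'S_n},
     allowable_graph Pi -> sweep_acycloid (topes_of_perms Pi))
  /\
  (forall T : {set signvec (pairs n)},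
     sweep_acycloid T ->
     (forall X : signvec (pairs n), X \in T -> supp X = [set: pairs n]) ->
     (forall X : signvec (pairs n), X \in T ->
        exists sigma : 'S_n, unique (partition_of X) (singletons sigma))
     /\ allowable_graph (perms_of_topes T)).
Proof.
split; first exact: allowable_graph_sweep_acycloid.
move=> T swT full; split; last exact: sweep_acycloid_allowable_graph.
move=> X XT; have [sigma <-] := tope_perm swT XT (full X XT).
exists sigma; split; first by rewrite partition_of_singletons.
by move=> I /partition_of_unique.
Qed.
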